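(* Let $G$ be a planar triangulation with planar dual $G^*$. Suppose that each vertex of $G$ is coloured either blue or red (the colouring is not required to be proper) such that: (i) every face of $G$ is incident to at least one blue vertex; (ii) there is no cycle of $G$ all of whose vertices are blue; and (iii) every cycle of $G$ all of whose vertices are red contains a vertex whose degree in $G$ is at most $4$. Then $G^*$ is Hamiltonian, that is, $G^*$ has a cycle passing through every vertex of $G^*$.
   Context: A planar triangulation is a finite simple graph with at least $4$ vertices, embedded in the plane (equivalently the sphere), in which every face, including the outer face, is bounded by a $3$-cycle. Its planar dual $G^*$ has one vertex for each face of $G$ (including the outer face), and for each edge $e$ of $G$ an edge joining the two faces incident to $e$; it is a cubic $3$-connected planar graph. ''Cycle of $G$'' means any cycle in $G$ as a subgraph (not necessarily induced or facial). *)

(* Defs.v *)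
From HB Require Import structures.
From mathcomp Require Import all_boot all_fingroup.

Set Implicit Arguments.
Unset Strict Implicit.
Unset Printing Implicit Defensive.

Record sgraph := SGraph {
  vertex :> finType;
  adj : rel vertex;
  adj_sym : symmetric adj;
  adj_irrefl : irreflexive adj
}.

(* Cycles are subgraph cycles of a simple graph, listed from an arbitrary
   starting point in an arbitrary direction; they need not be induced. *)
Definition is_cycle (T : eqType) (e : rel T) (c : seq T) : bool :=
  [&& 2 < size c, path.cycle e c & uniq c].

Definition hamiltonian (T : finType) (e : rel T) : Prop :=
  exists c : seq T, is_cycle e c /\ (forall x : T, x \in c).

Definition degree (G : sgraph) (v : G) : nat := #|[set w | adj v w]|.

Definition edges (G : sgraph) : {set {set G}} :=
  [set [set d.1; d.2] | d : G * G & adj d.1 d.2].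

(* A dart is an edge together with one of its two directions. *)
Definition dart (G : sgraph) : finType := {d : G * G | adj d.1 d.2}.

Definition tail (G : sgraph) (d : dart G) : G := (val d).1.
Definition head (G : sgraph) (d : dart G) : G := (val d).2.

Lemma rev_dart_subproof (G : sgraph) (d : dart G) : adj (head d) (tail d).
Proof. by rewrite adj_sym; exact: (valP d). Qed.

Definition rev_dart (G : sgraph) (d : dart G) : dart G :=
  exist (fun p : G * G => adj p.1 p.2) (head d, tail d) (rev_dart_subproof d).

Lemma rev_dartK (G : sgraph) : involutive (@rev_dart G).
Proof. by move=> d; apply: val_inj; case: d => -[]. Qed.

Definition rev_perm (G : sgraph) : {perm dart G} :=
  perm (can_inj (@rev_dartK G)).

(* The boundary walk of the face on one fixed side of d = (u, v) goes on with
   the dart following (v, u) in the rotation around v. *)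
Definition face_perm (G : sgraph) (rot : {perm dart G}) : {perm dart G} :=
  (rev_perm G * rot)%g.

(* A connected plane graph, given by its rotation system: rot sends a dart to
   the next one in the cyclic order of the edges around its tail.  A rotation
   system on a connected graph encodes, up to orientation-preserving
   homeomorphism, an embedding in a closed oriented surface whose faces are
   open discs, bounded by the cycles of face_perm; the surface is the sphere
   exactly when its Euler characteristic #V - #E + #F is 2. *)
Record plane_graph := PlaneGraph {
  pg_graph :> sgraph;
  rot : {perm dart pg_graph};
  rot_porbit : forall d, porbit rot d = [set d' | tail d' == tail d];
  pg_connected : forall u v : pg_graph, connect (@adj pg_graph) u v;
  pg_euler : #|pg_graph| + #|porbits (face_perm rot)| = #|edges pg_graph| + 2
}.

(* A face is identified with the set of darts of its boundary walk; no face
   is distinguished as the outer one. *)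
Definition face (G : plane_graph) : finType :=
  {F : {set dart G} | F \in porbits (face_perm (rot G))}.

Definition face_vertex (G : plane_graph) (F : face G) (v : G) : bool :=
  [exists d in val F, tail d == v].

Definition face_bounded_by (G : plane_graph) (F : face G) (c : seq G) : Prop :=
  is_cycle (@adj G) c /\
  forall d : dart G,
    (d \in val F) = (tail d \in c) && (next c (tail d) == head d).

Definition triangulation (G : plane_graph) : Prop :=
  4 <= #|G| /\
  forall F : face G, exists2 c : seq G, size c = 3 & face_bounded_by F c.

(* The faces on the two sides of an edge are those containing its two darts.
   The dual of a triangulation with at least 4 vertices is a simple graph, so
   an adjacency relation is enough to describe it. *)
Definition dual_adj (G : plane_graph) : rel (face G) :=
  fun F F' => [exists d : dart G, (d \in val F) && (rev_dart d \in val F')].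

(* Main.v *)
From mathcomp Require Import all_boot all_fingroup all_algebra.
From mathcomp Require Import zify.
From Stdlib Require Import Classical.
Require Import Defs.

(** It suffices to split the vertices into two sets S and ~: S that both span
    forests.  Then no face is monochromatic, so the edges between S and ~: S
    form a 2-factor of the dual.  One of its cycles K is a mod 2 cocycle of the
    sphere, hence the coboundary of a vertex set Y that is a union of components
    of S and of ~: S.  As the complement of a forest is connected, Y is S or
    ~: S, and K passes through all the faces.

    Such a partition is obtained from the given one by turning blue, one after
    the other, vertices v of degree at most 4 on red cycles.  Since no face is
    red, a red cycle through v uses opposite edges at v, so a blue cycle created
    by recolouring v would cross that red cycle at v and nowhere else, against
    the Jordan curve theorem.

    Both topological inputs are exactness statements mod 2 for the sequence
    vertices - edges - faces, which follow from connectedness of the graph and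
    of its dual and from Euler's formula by counting ranks. *)

Set Implicit Arguments.
Unset Strict Implicit.
Unset Printing Implicit Defensive.

Import GRing.Theory.

(** * Exactness of a three-term sequence by counting ranks *)

Section ExactSequence.
Local Open Scope ring_scope.
Variable K : fieldType.

Definition mx_of (A B : finType) (p : A -> B -> K) : 'M[K]_(#|A|, #|B|) :=
  \matrix_(i, j) p (enum_val i) (enum_val j).

Lemma mulmx_of (A B C : finType) (p : A -> B -> K) (q : B -> C -> K) :
  mx_of p *m mx_of q = mx_of (fun a c => \sum_b p a b * q b c).
Proof.
apply/matrixP => i j; rewrite !mxE.
rewrite (reindex (@enum_val _ (mem B))) /=; last exact/onW_bij/enum_val_bij.
by apply: eq_bigr => b _; rewrite !mxE.
Qed.

Lemma mulrow_of (A B : finType) (p : A -> B -> K) (u : 'rV[K]_#|A|) :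
  u *m mx_of p = \row_j \sum_a u 0 (enum_rank a) * p a (enum_val j).
Proof.
apply/rowP => j; rewrite !mxE.
rewrite [RHS](reindex (@enum_val _ (mem A))) /=; last exact/onW_bij/enum_val_bij.
by apply: eq_bigr => a _; rewrite !mxE enum_valK.
Qed.

(** The left kernel lies in the line of constant rows, so its dimension is at most 1. *)
Lemma rank_mx_of_connected (A B : finType) (p : A -> B -> K) :
    (forall x, (forall b, \sum_a x a * p a b = 0) ->
       exists k, forall a, x a = k) ->
  (#|A| <= (\rank (mx_of p)).+1)%N.
Proof.
move=> conn; rewrite -addn1 -leq_subLR -mxrank_ker.
suff: (kermx (mx_of p) <= (const_mx 1 : 'rV[K]_#|A|))%MS.
  by move/mxrankS/leq_trans; apply; apply: rank_leq_row.
apply/row_subP => i; set u := row i _.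
have uP0 : u *m mx_of p = 0.
  by apply/sub_kermxP; rewrite row_sub.
have [b|k uk] := conn (fun a => u 0 (enum_rank a)).
  move: uP0; rewrite mulrow_of => /rowP/(_ (enum_rank b)).
  by rewrite !mxE enum_rankK.
suff ->: u = k *: const_mx 1 by rewrite scalemx_sub.
apply/rowP => j; have := uk (enum_val j); rewrite enum_valK => <-.
by rewrite [RHS]mxE [X in _ * X]mxE mulr1.
Qed.

(** The image of [p] has dimension at least [#|V| - 1], the kernel of [q] at most [#|E| - #|F| + 1].
    These bounds agree by Euler's relation, so the inclusion of the image in the kernel is an
    equality. *)
Lemma exact_sequence (V E F : finType) (p : V -> E -> K) (q : E -> F -> K) :
    (forall x, (forall e, \sum_v x v * p v e = 0) ->
       exists k, forall v, x v = k) ->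
    (forall y, (forall e, \sum_f q e f * y f = 0) ->
       exists k, forall f, y f = k) ->
    (forall v f, \sum_e p v e * q e f = 0) ->
    (#|V| + #|F| = #|E| + 2)%N ->
  forall c, (forall f, \sum_e c e * q e f = 0) ->
  exists x, forall e, c e = \sum_v x v * p v e.
Proof.
move=> connV connF pq0 euler c cq0.
have rkP := rank_mx_of_connected connV.
have rkQ : (#|F| <= (\rank (mx_of q)).+1)%N.
  rewrite -mxrank_tr.
  have ->: (mx_of q)^T = mx_of (fun f e => q e f) by apply/matrixP=> i j; rewrite !mxE.
  apply: rank_mx_of_connected => y y0; apply: connF => e.
  by rewrite -[RHS](y0 e); apply: eq_bigr => f _; rewrite mulrC.
have PQ0 : mx_of p *m mx_of q = 0.
  by rewrite mulmx_of; apply/matrixP => i j; rewrite !mxE pq0.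
have PkerQ : (mx_of p <= kermx (mx_of q))%MS by apply/sub_kermxP.
have kerQP : (kermx (mx_of q) <= mx_of p)%MS.
  rewrite -(geq_leqif (mxrank_leqif_sup PkerQ)) mxrank_ker leq_subLR.
  rewrite -(leq_add2r 2) -euler addnC !addn2 -addSn -addnS.
  by rewrite leq_add.
pose u : 'rV[K]_#|E| := \row_j c (enum_val j).
have /submxP[w uw] : (u <= mx_of p)%MS.
  apply: submx_trans kerQP; apply/sub_kermxP; rewrite mulrow_of.
  apply/rowP => j; rewrite !mxE -[RHS](cq0 (enum_val j)).
  by apply: eq_bigr => e _; rewrite mxE enum_rankK.
exists (fun v => w 0 (enum_rank v)) => e.
move: uw; rewrite mulrow_of => /rowP/(_ (enum_rank e)).
by rewrite !mxE enum_rankK.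
Qed.

End ExactSequence.

(** * Mod 2 incidence between labelled darts and edges *)

Section Darts.
Local Open Scope ring_scope.

Lemma F2_addrr (x : 'F_2) : x + x = 0.
Proof. by apply/eqP; case: x => [[|[|]]] //. Qed.

Lemma F2_eq (x y : 'F_2) : x + y = 0 -> x = y.
Proof. by move=> xy; rewrite -[x]addr0 -(F2_addrr y) addrA xy add0r. Qed.

Variables (D V E F : finType) (r : D -> D) (t : D -> V) (ed : D -> E) (s : D -> F).
Hypothesis sum_ed : forall (h : D -> 'F_2) (d : D),
  \sum_(d' | ed d' == ed d) h d' = h d + h (r d).

Let inc (A : finType) (l : D -> A) a e : 'F_2 := \sum_(d | ed d == e) (l d == a)%:R.

Lemma sum_inc (A : finType) (l : D -> A) (x : A -> 'F_2) d :
  \sum_a x a * inc l a (ed d) = x (l d) + x (l (r d)).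
Proof.
rewrite /inc; under eq_bigr do rewrite sum_ed mulrDr.
rewrite big_split /=; congr (_ + _).
  rewrite (bigD1 (l d)) //= eqxx mulr1 big1 ?addr0 // => a /negPf.
  by rewrite eq_sym => ->; rewrite mulr0.
rewrite (bigD1 (l (r d))) //= eqxx mulr1 big1 ?addr0 // => a /negPf.
by rewrite eq_sym => ->; rewrite mulr0.
Qed.

Lemma sum_dart_edge (A : finType) (l : D -> A) (c : E -> 'F_2) a :
  \sum_e c e * inc l a e = \sum_(d | l d == a) c (ed d).
Proof.
rewrite [RHS](partition_big ed xpredT) //=; apply: eq_bigr => e _.
rewrite /inc mulr_sumr big_mkcond [RHS]big_mkcond /=; apply: eq_bigr => d _.
by case: eqP => [->|_]; case: eqP => _; rewrite ?mulr1 ?mulr0.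
Qed.

(** Vertices and faces enter only through the labels [t] and [s], so that one statement serves a
    graph and its dual. Writing edge functions as [c d + c (r d)] avoids choosing a dart for each
    edge. *)
Lemma dart_exact :
    (forall x : V -> 'F_2, (forall d, x (t d) = x (t (r d))) -> exists k, forall v, x v = k) ->
    (forall y : F -> 'F_2, (forall d, y (s d) = y (s (r d))) -> exists k, forall f, y f = k) ->
    (forall v f, \sum_(d | t d == v) ((s d == f)%:R + (s (r d) == f)%:R) = 0 :> 'F_2) ->
    (#|V| + #|F| = #|E| + 2)%N ->
  forall c : D -> 'F_2,
    (forall f, \sum_(d | s d == f) (c d + c (r d)) = 0) ->
  exists x, forall d, c d + c (r d) = x (t d) + x (t (r d)).
Proof.
move=> connV connF ts0 euler c c0.
pose c' e := \sum_(d | ed d == e) c d.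
have [||||f|x xP] := @exact_sequence _ V E F (inc t) (fun e f => inc s f e) _ _ _ _ c'.
- move=> x x0; apply: connV => d; apply: F2_eq; by rewrite -(sum_inc t x) x0.
- move=> y y0; apply: connF => d; apply: F2_eq; rewrite -(sum_inc s y) -[RHS](y0 (ed d)).
  by apply: eq_bigr => f _; rewrite mulrC.
- move=> v f; rewrite -[RHS](ts0 v f); under eq_bigr do rewrite mulrC.
  by rewrite sum_dart_edge; apply: eq_bigr => d _; rewrite /inc sum_ed.
- by [].
- by rewrite sum_dart_edge -[RHS](c0 f); apply: eq_bigr => d _; rewrite /c' sum_ed.
by exists x => d; rewrite -(sum_inc t x) -xP /c' sum_ed.
Qed.

End Darts.

Lemma porbit_const (T : finType) (A : Type) (s : {perm T}) (X : T -> A) x y :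
  (forall z, z \in porbit s x -> X (s z) = X z) -> y \in porbit s x -> X y = X x.
Proof.
move=> Xs /porbitP[i ->]; elim: i => [|i IH]; first by rewrite expg0 perm1.
by rewrite expgSr permM Xs ?mem_porbit.
Qed.

(** * Boundaries and coboundaries mod 2 in a plane graph *)

Section PlaneGraph.
Local Open Scope ring_scope.
Variable G : plane_graph.
Implicit Types (d : dart G) (F : face G) (u v w : G).

Let phi := face_perm (rot G).

Lemma tail_rev d : tail (rev_dart d) = head d. Proof. by []. Qed.
Lemma head_rev d : head (rev_dart d) = tail d. Proof. by []. Qed.

Lemma tail_rot d : tail (rot G d) = tail d.
Proof. by have := mem_porbit (rot G) 1 d; rewrite expg1 rot_porbit inE => /eqP. Qed.

Lemma face_permE d : phi d = rot G (rev_dart d).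
Proof. by rewrite permM permE. Qed.

Lemma tail_face_perm d : tail (phi d) = head d.
Proof. by rewrite face_permE tail_rot. Qed.

Lemma dart_inj d d' : tail d = tail d' -> head d = head d' -> d = d'.
Proof.
case: d d' => [[u v] a] [[u' v'] a']; rewrite /tail /head /= => tE hE.
by apply: val_inj => /=; rewrite tE hE.
Qed.

Lemma adj_dart u v : adj u v -> exists2 d, tail d = u & head d = v.
Proof. by move=> a; exists (exist (fun p : G * G => adj p.1 p.2) (u, v) a). Qed.

Lemma tail_neq_head d : tail d != head d.
Proof. by apply: contraTneq (valP d); rewrite /tail /head => ->; rewrite adj_irrefl. Qed.

Lemma rev_dart_neq d : rev_dart d != d.
Proof. by apply: contraNneq (tail_neq_head d) => {1}<-. Qed.

Lemma dface_subproof d : porbit phi d \in porbits phi.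
Proof. exact: imset_f. Qed.

Definition dface d : face G := exist _ (porbit phi d) (dface_subproof d).

Lemma mem_face d F : (d \in val F) = (dface d == F).
Proof.
rewrite -val_eqE; case: F => /= _ /imsetP[d' _ ->].
by rewrite eq_porbit_mem.
Qed.

Lemma dface_perm d : dface (phi d) = dface d.
Proof. by apply: val_inj => /=; exact: (porbit_perm phi 1). Qed.

Lemma dface_rot d : dface (rot G d) = dface (rev_dart d).
Proof. by rewrite -{1}(rev_dartK d) -face_permE dface_perm. Qed.

Lemma dface_onto F : exists d, F = dface d.
Proof. by case: F => _ /= /[dup] /imsetP[d _ ->] i; exists d; apply: val_inj. Qed.

Lemma const_around_vertex (A : Type) (X : dart G -> A) v :
    (forall d, tail d = v -> X (rot G d) = X d) ->
  forall d d', tail d = v -> tail d' = v -> X d = X d'.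
Proof.
move=> Xrot d d' dv d'v; apply: (@porbit_const _ _ (rot G)) => [z|].
  by rewrite rot_porbit inE d'v => /eqP/Xrot.
by rewrite rot_porbit inE dv d'v.
Qed.

Lemma const_vertex (A : Type) (x : G -> A) :
  (forall d, x (tail d) = x (tail (rev_dart d))) -> forall u v, x u = x v.
Proof.
move=> xd u v; have /connectP[p + ->] := pg_connected u v.
elim: p u => [//|w p IH] u /= /andP[/adj_dart[d <- <-] /IH <-].
by rewrite xd.
Qed.

(** The dual is connected: turning around a vertex crosses its edges one at a time, so [y] has a
    single value on the faces there, and a walk in [G] carries this value from vertex to vertex. *)
Lemma const_face (A : Type) (y : face G -> A) :
  (forall d, y (dface d) = y (dface (rev_dart d))) -> forall F F', y F = y F'.
Proof.
move=> yd F F'; have [d ->] := dface_onto F; have [d' ->] := dface_onto F'.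
have /connectP[p] := pg_connected (tail d) (tail d').
have yv d1 d2 : tail d1 = tail d2 -> y (dface d1) = y (dface d2).
  move=> eq_t; apply: (@const_around_vertex _ (y \o dface) (tail d2)) => // e _ /=.
  by rewrite dface_rot -yd.
elim: p d => [|w p IH] d /=; first by move=> _ /yv ->.
case/andP=> /adj_dart[e te he] pth lst.
by rewrite -(yv _ _ te) yd; apply: IH; rewrite tail_rev he.
Qed.

Lemma exists_const (A : finType) (B : Type) (b : B) (x : A -> B) :
  (forall a a', x a = x a') -> exists k, forall a, x a = k.
Proof.
by move=> xc; case: (pickP A) => [a _|A0]; [exists (x a)|exists b => a; have := A0 a].
Qed.

Lemma dedge_subproof d : [set tail d; head d] \in edges G.
Proof. by apply/imsetP; exists (val d); rewrite ?inE //; exact: (valP d). Qed.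

Definition dedge d : {e | e \in edges G} :=
  exist _ [set tail d; head d] (dedge_subproof d).

Lemma eq_dedge d d' : (dedge d' == dedge d) = (d' == d) || (d' == rev_dart d).
Proof.
rewrite -val_eqE /=; apply/eqP/orP; last first.
  by case=> /eqP ->; rewrite // tail_rev head_rev setUC.
move=> eqS; have := tail_neq_head d'.
have : tail d' \in [set tail d; head d] by rewrite -eqS set21.
have : head d' \in [set tail d; head d] by rewrite -eqS set22.
rewrite !inE => /orP[]/eqP hE /orP[]/eqP tE; rewrite hE tE ?eqxx // => _; [right|left];
  by apply/eqP; apply: dart_inj.
Qed.

Lemma dedge_onto e : exists d, e = dedge d.
Proof.
case: e => e /= /[dup] /imsetP[p]; rewrite inE => a -> i.
by exists (exist _ p a); apply: val_inj.
Qed.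

Lemma sum_dedge (M : nmodType) (h : dart G -> M) d :
  \sum_(d' | dedge d' == dedge d) h d' = h d + h (rev_dart d).
Proof.
rewrite (bigD1 d) //= (bigD1 (rev_dart d)) /=; last by rewrite eq_dedge eqxx orbT rev_dart_neq.
rewrite big1 ?addr0 // => d'; rewrite eq_dedge => /andP[/andP[/orP[]/eqP-> ]];
by rewrite ?eqxx.
Qed.

Lemma card_edge : #|{: {e | e \in edges G}}| = #|edges G|.
Proof. by rewrite card_sig. Qed.

(** The face of [rev_dart d] is that of [rot G d], and [rot G] permutes the darts at [v]; so the two
    halves of the sum are equal and cancel mod 2. *)
Lemma sum_vertex_boundary v (X : face G -> 'F_2) :
  \sum_(d | tail d == v) (X (dface d) + X (dface (rev_dart d))) = 0.
Proof.
rewrite big_split /= (reindex_inj (@perm_inj _ (rot G))) /=.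
under eq_bigl do rewrite tail_rot.
by rewrite -big_split big1 // => d _ /=; rewrite dface_rot F2_addrr.
Qed.

Lemma sum_face_vertex F v :
  \sum_(d | dface d == F) ((tail d == v)%:R + (tail (rev_dart d) == v)%:R) = 0 :> 'F_2.
Proof.
rewrite big_split /= (reindex_inj (@perm_inj _ (face_perm (rot G)))) /=.
under eq_bigl do rewrite dface_perm.
by rewrite -big_split big1 // => d _ /=; rewrite tail_face_perm F2_addrr.
Qed.

(** Vanishing of the first homology of the sphere mod 2: an edge set with even degree everywhere
    bounds a set of faces. This is [dart_exact] for the dual, faces playing the part of vertices. *)
Lemma boundary_of_cycle (c : dart G -> 'F_2) :
    (forall v, \sum_(d | tail d == v) (c d + c (rev_dart d)) = 0) ->
  exists X : face G -> 'F_2, forall d,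
    c d + c (rev_dart d) = X (dface d) + X (dface (rev_dart d)).
Proof.
apply: (dart_exact (t := dface) (s := @tail G) (@sum_dedge _)).
- by move=> y /const_face; apply: (exists_const 0).
- by move=> x /const_vertex; apply: (exists_const 0).
- exact: sum_face_vertex.
- by rewrite addnC card_edge -pg_euler card_sig.
Qed.

(** Vanishing of the first cohomology mod 2: an edge set meeting every face evenly is a cut. *)
Lemma coboundary_of_cocycle (c : dart G -> 'F_2) :
    (forall F, \sum_(d | dface d == F) (c d + c (rev_dart d)) = 0) ->
  exists Y : G -> 'F_2, forall d,
    c d + c (rev_dart d) = Y (tail d) + Y (head d).
Proof.
apply: (dart_exact (t := @tail G) (s := dface) (@sum_dedge _)).
- by move=> x /const_vertex; apply: (exists_const 0).
- by move=> y /const_face; apply: (exists_const 0).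
- by move=> v F; apply: (sum_vertex_boundary v (fun F' => (F' == F)%:R)).
- by rewrite card_edge -pg_euler card_sig.
Qed.

End PlaneGraph.

(** * Cycles in finite graphs *)

Section Cycles.
Local Open Scope ring_scope.
Variables (T : finType) (e : rel T).

Lemma rotate_cycle (c : seq T) v : is_cycle e c -> v \in c ->
  exists a z q, is_cycle e [:: v, a, z & q] /\ [:: v, a, z & q] =i c.
Proof.
case/and3P=> sz cyc un /rot_to[i c' rotE].
have := size_rot i c; have := rot_cycle i e c; have := rot_uniq i c; have := mem_rot i c.
rewrite rotE cyc un /is_cycle.
case: c' {rotE} => [|a [|z q]] eqi unE cycE sizeE; rewrite -sizeE // in sz.
by exists a, z, q; rewrite unE cycE.
Qed.

(** A path is extended at its head [x] by a neighbour [z] other than the second vertex [y]. Either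
    [z] is already on the path and closes a cycle, or the path grows. *)
Lemma min_degree2_cycle x0 y0 : symmetric e -> irreflexive e -> e x0 y0 ->
    (forall x y, e x y -> exists2 z, e x z & z != y) ->
  exists c, is_cycle e c.
Proof.
move=> e_sym e_irr e0 deg2.
have longer n : (exists c, is_cycle e c) \/
    exists x y p, [/\ path e x (y :: p), uniq [:: x, y & p] & size p = n].
  elim: n => [|n [|[x [y [p [xyp un sz]]]]]]; [right|by left|].
    exists x0, y0, nil; split=> //=; first by rewrite e0.
    by rewrite inE andbT; apply: contraTneq e0 => ->; rewrite e_irr.
  have [z xz zy] : exists2 z, e x z & z != y by apply: deg2; case/andP: xyp.
  have zx : z != x by apply: contraTneq xz => ->; rewrite e_irr.
  have [zp|zp] := boolP (z \in p); last first.
    right; exists z, x, (y :: p); split; last by rewrite /= sz.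
      by rewrite /= e_sym xz.
    by rewrite cons_uniq un andbT !inE !negb_or zx zy zp.
  left; case/splitPr: zp xyp un {sz} => p1 p2 xyp un.
  exists [:: x, y & rcons p1 z]; apply/and3P; split.
  - by rewrite /= size_rcons.
  - rewrite (cycle_path x) /= last_rcons e_sym xz /=.
    by move: xyp => /=; rewrite cat_path rcons_path /= => /and4P[-> -> ->].
  - apply: subseq_uniq un; rewrite -cat_rcons -!cat_cons.
    exact: prefix_subseq.
(* This path would have [#|T| + 2] distinct vertices. *)
have [//|[x [y [p [_ /card_uniqP un sz]]]]] := longer #|T|.
by have := max_card (mem [:: x, y & p]); rewrite un /= sz ltnNge leqnSn.
Qed.

End Cycles.

Definition acyclic (G : sgraph) (S : {set G}) : Prop :=
  ~ exists c, is_cycle (@adj G) c /\ {subset c <= S}.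

(** * Face sets whose boundary lies in a forest *)

Section Triangulation.
Local Open Scope ring_scope.
Variable G : plane_graph.
Implicit Types (d : dart G) (F : face G) (u v w : G) (S : {set G}).

(** The edges across which [X] changes have even degree at each vertex. If there were any, they
    would contain a cycle, with all its vertices in [S]. *)
Lemma boundary_in_acyclic S (X : face G -> 'F_2) : acyclic S ->
    (forall d, X (dface d) != X (dface (rev_dart d)) -> tail d \in S) ->
  forall F F', X F = X F'.
Proof.
move=> acS bdS; apply: const_face => d0; apply/eqP/negPn/negP => Xd0.
apply: acS; pose B d := X (dface d) != X (dface (rev_dart d)).
have revB d : B (rev_dart d) = B d by rewrite /B rev_dartK eq_sym.
pose e u v := [exists d, [&& tail d == u, head d == v & B d]].
have e_adj u v : e u v -> adj u v.
  by case/existsP=> d /and3P[/eqP<- /eqP<- _]; apply: (valP d).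
have eS u v : e u v -> u \in S.
  by case/existsP=> d /and3P[/eqP<- _ /bdS].
have e_sym : symmetric e.
  suff sub u v : e u v -> e v u by move=> u v; apply/idP/idP; apply: sub.
  case/existsP=> d /and3P[tE hE Bd]; apply/existsP; exists (rev_dart d).
  by rewrite tail_rev head_rev tE hE revB.
have [||||c cyc] := @min_degree2_cycle _ e (tail d0) (head d0).
- exact: e_sym.
- by move=> u; apply/negbTE/negP => /e_adj; rewrite adj_irrefl.
- by apply/existsP; exists d0; rewrite !eqxx.
- move=> u v /existsP[d /and3P[/eqP tE /eqP hE Bd]].
  have [d' /and3P[t' B' n']|none] := pickP [pred d' | [&& tail d' == u, B d' & d' != d]].
    exists (head d'); first by apply/existsP; exists d'; rewrite t' B' eqxx.
    apply: contra n' => /eqP h'; apply/eqP/dart_inj; last by rewrite h' hE.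
    by rewrite (eqP t') tE.
  (* Were [d] the only such dart at [u], the vanishing sum at [u] would reduce to the term of
     [d]. *)
  case/eqP: (Bd); apply: F2_eq; rewrite -[RHS](sum_vertex_boundary u X).
  rewrite [RHS](bigD1 d) ?tE //= big1 ?addr0 // => d' /andP[t' n'].
  have := none d'; rewrite /= t' n' andbT => /negbFE/eqP ->.
  exact: F2_addrr.
exists c; split; case/and3P: cyc => sz cyc un; last first.
  by move=> u /(next_cycle cyc)/eS.
by apply/and3P; split=> //; apply: sub_cycle cyc; apply: e_adj.
Qed.

(** * Triangular faces *)

Hypothesis triG : triangulation G.
Let phi := face_perm (rot G).

Lemma next3 (T : eqType) (c : seq T) x : size c = 3 -> uniq c -> x \in c ->
  next c (next c (next c x)) = x.
Proof.
case: c => [|a [|b [|z [|]]]] //= _; rewrite !inE.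
case/and3P=> /norP[ab az] bz _.
have [ba za zb] : [/\ (b == a) = false, (z == a) = false & (z == b) = false].
  by split; rewrite eq_sym; apply: negbTE.
by case/or3P=> /eqP ->; rewrite ?(eqxx, ba, za, zb).
Qed.

Lemma face_perm3 d : phi (phi (phi d)) = d.
Proof.
have [c sz [cyc inF]] := (proj2 triG) (dface d).
have hd e : dface e = dface d -> next c (tail e) = head e.
  by move=> eqF; apply/eqP; have := inF e; rewrite mem_face eqF eqxx => /esym/andP[].
have dc : tail d \in c.
  by have := inF d; rewrite mem_face eqxx => /esym/andP[].
have un : uniq c by case/and3P: cyc.
have t1 : tail (phi d) = next c (tail d) by rewrite tail_face_perm hd.
have t2 : tail (phi (phi d)) = next c (next c (tail d)).
  by rewrite tail_face_perm -hd ?dface_perm // t1.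
have t3 : tail (phi (phi (phi d))) = tail d.
  by rewrite tail_face_perm -hd ?dface_perm // t2 next3.
by apply: dart_inj => //; rewrite -!hd ?dface_perm // t3.
Qed.

Lemma eq_dface d d' : (dface d' == dface d) = [|| d' == d, d' == phi d | d' == phi (phi d)].
Proof.
apply/idP/idP => [|/or3P[]/eqP->]; rewrite ?dface_perm //.
rewrite -mem_face => /porbitP[i ->].
elim: i => [|i IH]; first by rewrite expg0 perm1 eqxx.
rewrite expgSr permM; case/or3P: IH => /eqP->; rewrite -/phi ?face_perm3 ?eqxx ?orbT //.
Qed.

Lemma face_perm_neq d : [/\ phi d != d, phi (phi d) != d & phi (phi d) != phi d].
Proof.
have neq e : phi e != e.
  by apply: contraNneq (tail_neq_head e) => eqe; rewrite -tail_face_perm -/phi eqe.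
split=> //; apply: contraNneq (neq (phi (phi d))) => eqd.
by rewrite face_perm3 eqd.
Qed.

Lemma sum_dface (M : nmodType) (h : dart G -> M) d :
  \sum_(d' | dface d' == dface d) h d' = h d + h (phi d) + h (phi (phi d)).
Proof.
have [n1 n2 n3] := face_perm_neq d.
rewrite (bigD1 d) //= (bigD1 (phi d)) /=; last by rewrite dface_perm eqxx.
rewrite (bigD1 (phi (phi d))) /=; last by rewrite !dface_perm eqxx n2.
rewrite big1 ?addr0 ?addrA // => d'; rewrite eq_dface -!andbA.
by case/and4P=> /or3P[]/eqP->; rewrite ?eqxx.
Qed.

(** Counting darts by faces and by edges gives [3F = 2E], whence [F = 2V - 4] by Euler's formula. *)
Lemma card_face : (3 < #|face G|)%N.
Proof.
have dF : #|dart G| = (3 * #|face G|)%N.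
  rewrite -sum1_card (partition_big (@dface G) xpredT) //= mulnC -sum_nat_const.
  apply: eq_bigr => F _; have [d ->] := dface_onto F.
  exact: (sum_dface (fun=> 1%N)).
have dE : #|dart G| = (2 * #|edges G|)%N.
  rewrite -card_edge -sum1_card (partition_big (@dedge G) xpredT) //= mulnC -sum_nat_const.
  apply: eq_bigr => e _; have [d ->] := dedge_onto e.
  exact: (sum_dedge (fun=> 1%N)).
have := pg_euler G; have := proj1 triG.
have -> : #|porbits (face_perm (rot G))| = #|face G| by rewrite card_sig.
have : (3 * #|face G| = 2 * #|edges G|)%N by rewrite -dF.
move: #|face G| #|edges G| #|G| => f e n; lia.
Qed.

Lemma dart_at v : exists d, tail d = v.
Proof.
have /card_gt0P[u] : (0 < #|[set~ v]|)%N.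
  by rewrite cardsC1; case: #|G| (proj1 triG) => [|[]].
rewrite !inE => uv; have /connectP[[|w p] /=] := pg_connected v u.
  by move=> _ uE; rewrite uE eqxx in uv.
by case/andP=> /adj_dart[d tE _] _ _; exists d.
Qed.

(** * Connectedness of the complement of a forest *)

Lemma face_adj (A : Type) (Y : G -> A) (P : pred G) d d' :
    (forall e, P (tail e) -> P (head e) -> Y (tail e) = Y (head e)) ->
  dface d' = dface d -> P (tail d) -> P (tail d') -> Y (tail d') = Y (tail d).
Proof.
move=> Yadj /eqP; rewrite eq_dface => /or3P[]/eqP-> //.
  by rewrite tail_face_perm => Pd Pd'; rewrite Yadj.
move=> Pd Pd'; have := Yadj (phi (phi d)).
by rewrite -(tail_face_perm (phi (phi d))) -/phi face_perm3 => ->.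
Qed.

Lemma acyclic_compl_connected (A : eqType) S (Y : G -> A) : acyclic S ->
    (forall d, tail d \notin S -> head d \notin S -> Y (tail d) = Y (head d)) ->
  forall u v, u \notin S -> v \notin S -> Y u = Y v.
Proof.
move=> acS Yadj u v uS vS.
(* The boundary of the union of the faces that meet [set w in ~: S | Y w == Y v]
   has all its edges within S. *)
pose X F : 'F_2 := [exists d, [&& dface d == F, tail d \notin S & Y (tail d) == Y v]]%:R.
have XE d : tail d \notin S -> X (dface d) = (Y (tail d) == Y v)%:R.
  move=> dS; congr (_%:R); congr nat_of_bool; apply/existsP/idP => [[d'] | Yd].
    case/and3P=> /eqP eqF d'S /eqP <-; apply/eqP/esym.
    exact: (face_adj (P := [pred w | w \notin S]) Yadj).
  by exists d; rewrite eqxx dS.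
(* Both faces have [tail d] as a corner; if it is outside [S], it decides both values by [XE]. *)
have XS d : X (dface d) != X (dface (rev_dart d)) -> tail d \in S.
  by apply: contraNT => dS; rewrite -dface_rot !XE ?tail_rot.
have [du tu] := dart_at u; have [dv tv] := dart_at v.
have := boundary_in_acyclic acS XS (dface du) (dface dv).
rewrite !XE ?tu ?tv // eqxx; by case: eqP.
Qed.

(** * The Jordan curve theorem mod 2 and recolouring *)

Lemma dart_at_neighbour v u : adj v u -> exists d, forall d',
  (tail d' == v) && (head d' == u) = (d' == d).
Proof.
case/adj_dart=> d <- <-; exists d => d'.
by apply/andP/eqP => [[/eqP t /eqP h]|->]; [apply: dart_inj | rewrite !eqxx].
Qed.

Lemma sum_neighbour v u (M : nmodType) (x : M) : adj v u ->
  \sum_(d | tail d == v) (if head d == u then x else 0) = x.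
Proof.
case/dart_at_neighbour=> d dP.
by rewrite -big_mkcondr /= (eq_bigl _ _ dP) big_pred1_eq.
Qed.

(** Here [X] tells the two sides of [c] apart. It exists by [boundary_of_cycle], since a vertex of
    [c] has one cycle edge to its successor and one to its predecessor. *)
Lemma cycle_separates c : is_cycle (@adj G) c ->
  exists X : face G -> 'F_2, forall d,
    X (dface d) + X (dface (rev_dart d)) =
      ((tail d \in c) && (next c (tail d) == head d))%:R +
      ((head d \in c) && (next c (head d) == tail d))%:R.
Proof.
case/and3P=> sz cyc un.
pose f d : 'F_2 := ((tail d \in c) && (next c (tail d) == head d))%:R.
have [w|X XP] := @boundary_of_cycle G f; last by exists X => d; rewrite -XP.
rewrite big_split /=.
have [wc|wc] := boolP (w \in c); last first.
  rewrite !big1 ?addr0 // => d /eqP tE; rewrite /f ?tail_rev ?head_rev tE ?(negPf wc) //.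
  by have [hc|//] := boolP (head d \in c); case: eqP => // nE; rewrite -nE mem_next hc in wc.
rewrite -[RHS](F2_addrr 1); congr (_ + _).
  rewrite -[RHS](sum_neighbour _ (next_cycle cyc wc)); apply: eq_bigr => d /eqP tE.
  by rewrite /f tE wc eq_sym /=; case: eqP.
have wp : adj w (prev c w) by rewrite adj_sym; apply: prev_cycle.
rewrite -[RHS](sum_neighbour _ wp); apply: eq_bigr => d /eqP tE.
rewrite /f tail_rev head_rev tE; have [hE|hE] := altP (head d =P prev c w).
  by rewrite hE mem_prev wc next_prev // eqxx.
case: andP => // -[_ /eqP nE]; case/eqP: hE.
by rewrite -nE prev_next.
Qed.

Lemma next_uniq_cycle (T : eqType) (v a z : T) q : uniq [:: v, a, z & q] ->
  let c := [:: v, a, z & q] in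
  [/\ next c v = a, next c (prev c v) = v, next c a != v & prev c v != a].
Proof.
move=> un c; have nv : next c v = a by rewrite /= eqxx.
have na : next c a = z.
  by case/andP: un; rewrite inE negb_or eq_sym => /andP[/negPf av _] _; rewrite /= av eqxx.
have nza : next c a != v.
  by rewrite na eq_sym; case/andP: un; rewrite !inE !negb_or => /and3P[].
split=> //; first by rewrite next_prev.
by apply: contraNneq nza => <-; rewrite next_prev.
Qed.

(** The face of [rev_dart d] has as corners the ends of [d] and [head (rot G d)]. *)
Lemma third_vertex_in S d :
    (forall F, exists2 v, face_vertex F v & v \in S) ->
  tail d \notin S -> head d \notin S -> head (rot G d) \in S.
Proof.
move=> hS tS hhS; have [v /existsP[d' /andP[]]] := hS (dface (rev_dart d)).
rewrite mem_face eq_dface => d'E /eqP tv vS; move: d'E.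
case/or3P=> /eqP dE; move: tv; rewrite dE.
- by rewrite tail_rev => eqv; rewrite eqv vS in hhS.
- by rewrite tail_face_perm head_rev => eqv; rewrite eqv vS in tS.
by rewrite tail_face_perm face_permE rev_dartK => ->.
Qed.

(** The red cycle and a new blue cycle use all edges at [v]. The red path puts the faces at both red
    edges on one side of the blue cycle, and a rotation step from a red edge leads to a blue one. So
    all faces at [v] are on one side, although the blue cycle separates the two faces at each of its
    edges. *)
Lemma acyclic_recolour S c v :
    (forall F, exists2 w, face_vertex F w & w \in S) ->
    acyclic S -> is_cycle (@adj G) c -> {subset c <= ~: S} -> v \in c ->
    (degree v <= 4)%N ->
  acyclic (v |: S).
Proof.
move=> hS acS cyc cS vc deg4 [b [cycb bS]].
have vb : v \in b.
  apply/negPn/negP => vb; apply: acS; exists b; split=> // w wb.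
  by have := bS w wb; rewrite !inE => /predU1P[wv|//]; rewrite -wv wb in vb.
have [a [z [q [cyc' eqc]]]] := rotate_cycle cyc vc.
have [b1 [z' [q' [cycb' eqb]]]] := rotate_cycle cycb vb.
move: cyc' cycb' eqc eqb; set c' := [:: v, a, z & q]; set b' := [:: v, b1, z' & q'].
move=> cyc' cycb' eqc eqb.
have [_ _ unb] := and3P cycb'.
have [nbv nbp nb1 nep] := next_uniq_cycle unb; rewrite -/b' in nbv nbp nb1 nep.
set b2 := prev b' v in nbp nep.
have [X XP] := cycle_separates cycb'.
have vS : v \notin S by have := cS v vc; rewrite inE.
have red w : w \in c' -> w \notin S by rewrite eqc => /cS; rewrite inE.
have blue w : w \in b' -> w != v -> w \in S.
  by rewrite eqb => /bS; rewrite !inE => /orP[->|].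
have vb' : v \in b' by rewrite eqb.
have notb w : w \in [:: a, z & q] -> w \notin b'.
  move=> wc; apply/negP => wb.
  have /negP[] : w \notin S by apply: red; rewrite inE wc orbT.
  apply: blue => //; apply: contraTneq wc => ->.
  by case/and3P: cyc' => _ _ /andP[].
have Xoff d : (tail d \notin b') || (head d \notin b') -> X (dface d) = X (dface (rev_dart d)).
  move=> off; apply: F2_eq; rewrite XP.
  suff [-> ->] : (tail d \in b') && (next b' (tail d) == head d) = false /\
     (head d \in b') && (next b' (head d) == tail d) = false by rewrite addr0.
  by split; apply: contraTF off => /andP[h /eqP<-]; rewrite mem_next h.
have Xat w d d' : w \notin b' -> tail d = w -> tail d' = w -> X (dface d) = X (dface d').
  move=> wb; apply: (@const_around_vertex _ _ (fun d => X (dface d))) => e te.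
  by rewrite dface_rot -Xoff // te wb.
set a' := last z q.
(* The faces at a and at a' lie on the same side of the blue cycle b', because the
   red path from a to a' avoids it. *)
have Xpath p x d d' : {in x :: p, forall w, w \notin b'} -> path (@adj G) x p ->
    tail d = x -> tail d' = last x p -> X (dface d) = X (dface d').
  elim: p x d => [|w p IH] x d off /=.
    by move=> _ tx t'; apply: (Xat x) => //; apply: off; apply: mem_head.
  case/andP=> /adj_dart[e te he] pth tx t'.
  have xb := off x (mem_head _ _).
  rewrite (Xat _ _ e xb tx te) Xoff ?te ?xb //.
  by apply: (IH w) => // y yp; apply: off; rewrite inE yp orbT.
have adj_va : adj v a by case/and3P: cyc' => _ /andP[].
have adj_va' : adj v a'.
  rewrite adj_sym; case/and3P: cyc' => _; rewrite /c' /= rcons_path.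
  by case/and3P=> _ _ /andP[].
have adj_vb1 : adj v b1 by case/and3P: cycb' => _ /andP[].
have adj_vb2 : adj v b2 by rewrite adj_sym; apply: prev_cycle => //; case/and3P: cycb'.
have aS : a \notin S by apply: red; rewrite !inE eqxx orbT.
have a'S : a' \notin S by apply: red; rewrite !(inE, mem_last) -in_cons mem_last !orbT.
have b1v : b1 != v by case/and3P: cycb' => _ _ /andP[]; rewrite inE negb_or eq_sym => /andP[].
have b1S : b1 \in S by apply: blue; rewrite // !inE eqxx orbT.
have b2S : b2 \in S by apply: blue; rewrite ?mem_prev //; apply: contraTneq adj_vb2 => ->; rewrite adj_irrefl.
have aa' : a != a'.
  case/and3P: cyc' => _ _ /and3P[_ + _]; apply: contraNneq => ->; exact: mem_last.
(* Two red and two blue neighbours, all distinct, exhaust a neighbourhood of size at most 4. *)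
have nbrs w : adj v w -> w \in [:: a; a'; b1; b2].
  have un4 : uniq [:: a; a'; b1; b2].
    have neq x y : x \notin S -> y \in S -> (x == y) = false.
      by move=> xS yS; apply: contraNF xS => /eqP->.
    by rewrite /= !inE (negPf aa') (neq a b1 aS b1S) (neq a b2 aS b2S)
      (neq a' b1 a'S b1S) (neq a' b2 a'S b2S) eq_sym nep.
  have sub : {subset [:: a; a'; b1; b2] <= enum [set w | adj v w]}.
    by move=> x; rewrite mem_enum !inE => /or4P[]/eqP->.
  have [|_ eqN] := uniq_min_size un4 sub; first by rewrite -cardE.
  by rewrite eqN mem_enum inE.
have [ea ta ha] := adj_dart adj_va; have [ea' ta' ha'] := adj_dart adj_va'.
have [e1 t1 h1] := adj_dart adj_vb1; have [e2 t2 h2] := adj_dart adj_vb2.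
(* Otherwise the face between [d] and [rot G d] would be red. *)
have rotb d : tail d = v -> head d \notin S -> rot G d = e1 \/ rot G d = e2.
  move=> td hd; have td' : tail (rot G d) = v by rewrite tail_rot.
  have := third_vertex_in hS (d := d); rewrite td => /(_ vS hd) rS.
  have /nbrs : adj v (head (rot G d)) by rewrite -td'; apply: (valP (rot G d)).
  rewrite !inE => /or4P[]/eqP hE; rewrite ?hE ?(negPf aS) ?(negPf a'S) // in rS.
    by left; apply: dart_inj; rewrite ?td' ?t1 ?hE ?h1.
  by right; apply: dart_inj; rewrite ?td' ?t2 ?hE ?h2.
have a_b : a \notin b' by apply: notb; rewrite inE eqxx.
have a'_b : a' \notin b' by apply: notb; rewrite inE mem_last orbT.
have Xrev d : head d \notin b' -> X (dface (rot G d)) = X (dface d).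
  by move=> hb; rewrite dface_rot -Xoff // hb orbT.
have Xaa' : X (dface ea) = X (dface ea').
  have pth : path (@adj G) a (z :: q).
    by case/and3P: cyc' => _; rewrite /c' /= rcons_path => /and3P[_ -> /andP[-> _]].
  rewrite -(Xrev ea) ?ha // -(Xrev ea') ?ha' // !dface_rot.
  exact: (Xpath _ _ (rev_dart ea) (rev_dart ea') notb pth ha ha').
(* As [rot G] is injective, it sends [ea] and [ea'] to [e1] and [e2] in some order. *)
have Xb : X (dface e1) = X (dface ea) /\ X (dface e2) = X (dface ea).
  have rneq : rot G ea != rot G ea'.
    by apply: contra aa' => /eqP/perm_inj eqe; rewrite -ha eqe ha'.
  have := Xrev ea'; have := Xrev ea; rewrite ha ha' => /(_ a_b) Xa /(_ a'_b) Xa'.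
  have := rotb ea; have := rotb ea'; rewrite ta ta' ha ha'.
  move=> /(_ erefl a'S)[] ra' /(_ erefl aS)[] ra; rewrite ra ra' ?eqxx // in rneq Xa Xa'.
    by rewrite Xa Xa' Xaa'.
  by rewrite Xa Xa' Xaa'.
(* The edge of [e1] lies on [b'] and separates these faces; yet [rot G e1] is one of the four darts
   at [v], on which [X] agrees. *)
have /negP[] : X (dface e1) != X (dface (rot G e1)).
  apply/eqP => eqX; have := XP e1; rewrite -dface_rot -eqX F2_addrr t1 h1 vb' nbv eqxx.
  by rewrite (negPf nb1) andbF.
have tr1 : tail (rot G e1) = v by rewrite tail_rot.
have /nbrs : adj v (head (rot G e1)) by rewrite -tr1; apply: (valP (rot G e1)).
rewrite !inE Xb.1 => /or4P[]/eqP hE; apply/eqP.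
- by congr (X (dface _)); apply: dart_inj; rewrite ?tr1 ?hE.
- by rewrite Xaa'; congr (X (dface _)); apply: dart_inj; rewrite ?tr1 ?hE.
- by rewrite -Xb.1; congr (X (dface _)); apply: dart_inj; rewrite ?tr1 ?hE.
by rewrite -Xb.2; congr (X (dface _)); apply: dart_inj; rewrite ?tr1 ?hE.
Qed.

(** * From two forests to a Hamiltonian cycle of the dual *)

Lemma acyclic_face S d : acyclic S ->
  ~~ [&& tail d \in S, tail (phi d) \in S & tail (phi (phi d)) \in S].
Proof.
move=> acS; apply/negP => /and3P[s0 s1 s2].
pose x := tail d; pose y := tail (phi d); pose z := tail (phi (phi d)).
have hz : head (phi (phi d)) = tail d by rewrite -tail_face_perm -/phi face_perm3.
apply: acS; exists [:: x; y; z]; split; last first.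
  by move=> w; rewrite !inE => /or3P[]/eqP->.
have hx : head d = y by rewrite -tail_face_perm.
have hy : head (phi d) = z by rewrite -tail_face_perm.
apply/and3P; split=> //=.
  rewrite andbT; apply/and3P; split.
  - by rewrite -hx; apply: (valP d).
  - by rewrite -hy; apply: (valP (phi d)).
  by rewrite /x -hz; apply: (valP (phi (phi d))).
have := tail_neq_head d; have := tail_neq_head (phi d); have := tail_neq_head (phi (phi d)).
rewrite hx hy hz -/x -/y -/z !inE negb_or eq_sym andbT.
by move=> -> -> ->.
Qed.

(** Both colours occur on the triangle, so a tour of it leaves [S] exactly once. *)
Lemma unique_crossing S F : acyclic S -> acyclic (~: S) ->
  exists d, forall d', [&& dface d' == F, tail d' \in S & head d' \notin S] = (d' == d).
Proof.
move=> acS acC; have [d ->] := dface_onto F.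
have := acyclic_face d acS; have := acyclic_face d acC; rewrite !inE.
have h0 : head d = tail (phi d) by rewrite tail_face_perm.
have h1 : head (phi d) = tail (phi (phi d)) by rewrite -tail_face_perm.
have h2 : head (phi (phi d)) = tail d by rewrite -tail_face_perm -/phi face_perm3.
case b0: (tail d \in S); case b1: (tail (phi d) \in S);
  case b2: (tail (phi (phi d)) \in S) => // _ _;
  [exists (phi d) | exists d | exists d | exists (phi (phi d))
  | exists (phi d) | exists (phi (phi d))];
  move=> d'; apply/idP/eqP => [/and3P[] | ->];
  rewrite ?dface_perm ?eqxx ?h0 ?h1 ?h2 ?b0 ?b1 ?b2 //;
  by rewrite eq_dface => /or3P[]/eqP->; rewrite -/phi ?h0 ?h1 ?h2 ?b0 ?b1 ?b2.
Qed.

Lemma tree_partition_hamiltonian S : acyclic S -> acyclic (~: S) -> hamiltonian (@dual_adj G).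
Proof.
move=> acS acC; have acC' : acyclic (~: ~: S) by rewrite setCK.
have [inn innP] := fin_all_exists (fun F => unique_crossing F acS acC).
have [out outP] := fin_all_exists (fun F => unique_crossing F acC acC').
have {}outP F d : [&& dface d == F, tail d \notin S & head d \in S] = (d == out F).
  by rewrite -outP !inE negbK.
have outF F : [/\ dface (out F) = F, tail (out F) \notin S & head (out F) \in S].
  by have := outP F (out F); rewrite eqxx => /and3P[/eqP].
have innF F : [/\ dface (inn F) = F, tail (inn F) \in S & head (inn F) \notin S].
  by have := innP F (inn F); rewrite eqxx => /and3P[/eqP].
(* g runs along the dual 2-factor with S on a fixed side. *)
pose g F := dface (rev_dart (out F)).
(* The dart entering [S] from [F] is, reversed, the one leaving [S] in the face across. *)
have rev_out F : rev_dart (out F) = inn (g F).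
  apply/eqP; rewrite -innP eqxx tail_rev head_rev.
  by have [_ -> ->] := outF F.
have gI : injective g.
  move=> F F' eqg; have [<- _ _] := outF F; have [<- _ _] := outF F'.
  by rewrite -(rev_dartK (out F)) -(rev_dartK (out F')) !rev_out eqg.
have g_inn F : g (dface (rev_dart (inn F))) = F.
  rewrite /g (_ : out _ = rev_dart (inn F)); last first.
    by apply/esym/eqP; rewrite -outP eqxx tail_rev head_rev; have [_ -> ->] := innF F.
  by rewrite rev_dartK; have [] := innF F.
have [F0] : exists F0 : face G, True.
  by have /card_gt0P[F _] := ltn_trans (isT : (0 < 3)%N) card_face; exists F.
move=> _; pose K F := fconnect g F0 F.
have Kg F : K (g F) = K F by rewrite /K -(same_fconnect1_r gI).
(* Only darts from [~: S] to [S] count, so [f d + f (rev_dart d)] indicates the edges crossed by the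
   orbit of [F0]. *)
pose f d : 'F_2 := [&& tail d \notin S, head d \in S & K (dface d)]%:R.
have [F|Y YP] := @coboundary_of_cocycle G f.
  (* In each face [F] only [out F] and [inn F] contribute, both with the value of [K F]. *)
  rewrite big_split /=.
  rewrite (bigD1 (out F)) /=; last by have [-> ] := outF F.
  rewrite [X in _ + X = _](bigD1 (inn F)) /=; last by have [-> ] := innF F.
  rewrite !big1 ?addr0; first 1 last.
  - move=> d /andP[dF]; rewrite -innP dF /f tail_rev head_rev /=.
    by case: (tail d \in S); case: (head d \in S).
  - move=> d /andP[dF]; rewrite -outP dF /f /=.
    by case: (tail d \in S); case: (head d \in S).
  rewrite /f tail_rev head_rev -[K (dface (rev_dart _))]Kg g_inn.
  have [-> -> ->] := outF F; have [_ -> ->] := innF F.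
  exact: F2_addrr.
have f0 d : (tail d \in S) = (head d \in S) -> f d = 0.
  by rewrite /f => ->; case: (head d \in S).
have mono d : (tail d \in S) = (head d \in S) -> Y (tail d) = Y (head d).
  by move=> eqd; apply: F2_eq; rewrite -YP !f0 ?addr0.
have YC u v : u \notin S -> v \notin S -> Y u = Y v.
  apply: (acyclic_compl_connected acS) => d tS hS; apply: mono.
  by rewrite (negPf tS) (negPf hS).
have YS u v : u \in S -> v \in S -> Y u = Y v.
  move=> uS vS; apply: (acyclic_compl_connected acC); rewrite ?inE ?negbK // => d.
  by rewrite !inE !negbK => tS hS; apply: mono; rewrite tS hS.
have fout F : f (out F) + f (rev_dart (out F)) = (K F)%:R.
  by rewrite /f tail_rev head_rev; have [-> -> ->] := outF F; rewrite addr0.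
(* The value of [K F] is that of [Y] on [S] plus that on [~: S], hence the same for every face. *)
have KE F : K F.
  have : (K F)%:R = (K F0)%:R :> 'F_2.
    rewrite -!fout !YP; have [_ t h] := outF F; have [_ t0 h0] := outF F0.
    by congr (_ + _); [apply: YC | apply: YS].
  by rewrite {2}/K connect0; case: (K F).
exists (fingraph.orbit g F0); split; last by move=> F; rewrite -fconnect_orbit; apply: KE.
apply/and3P; split; last exact: orbit_uniq.
- rewrite -(card_uniqP (orbit_uniq g F0)).
  rewrite (_ : #|_| = #|face G|); first exact: ltnW card_face.
  by apply: eq_card => F; rewrite -fconnect_orbit inE; apply: KE.
- apply: sub_cycle (cycle_orbit gI F0) => F F' /= /eqP <-.
  by apply/existsP; exists (out F); rewrite !mem_face eqxx andbT; have [->] := outF F.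
Qed.

(** Induction on the number of red vertices: the conditions on faces and on red cycles survive when
    [S] grows, and [acyclic_recolour] keeps [S] acyclic. *)
Lemma acyclic_extension S :
    (forall F, exists2 v, face_vertex F v & v \in S) -> acyclic S ->
    (forall c, is_cycle (@adj G) c -> {subset c <= ~: S} ->
       exists2 v, v \in c & (degree v <= 4)%N) ->
  exists S', acyclic S' /\ acyclic (~: S').
Proof.
have [n] := ubnP #|~: S|; elim: n S => // n IH S Sn hS acS red.
have [acC|/NNPP[c [cyc cS]]] := classic (acyclic (~: S)); first by exists S.
have [v vc deg4] := red c cyc cS; have vS := cS v vc.
have SvS : ~: (v |: S) \subset ~: S by rewrite setCS subsetUr.
apply: (IH (v |: S)).
- apply: leq_trans (Sn : (_ <= n)%N); apply/proper_card/properP; split=> //.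
  by exists v; rewrite // !inE eqxx.
- by move=> F; have [w wF wS] := hS F; exists w; rewrite // inE wS orbT.
- exact: (acyclic_recolour hS acS cyc cS vc deg4).
- by move=> c' cyc' c'S; apply: red => // w /c'S; apply: (subsetP SvS).
Qed.

End Triangulation.

Theorem theorem1 (G : plane_graph) (hG : triangulation G) (blue : {set G})
  (h_face : forall F : face G, exists2 v : G, face_vertex F v & v \in blue)
  (h_blue : ~ exists c : seq G, is_cycle (@adj G) c /\ {subset c <= blue})
  (h_red : forall c : seq G, is_cycle (@adj G) c -> {subset c <= ~: blue} ->
     exists2 v : G, v \in c & degree v <= 4) :
  hamiltonian (@dual_adj G).
Proof.
have [S [acS acC]] := acyclic_extension hG h_face h_blue h_red.
exact: (tree_partition_hamiltonian hG acS acC).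
Qed.
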